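(* Let $X$ be a locally compact locale and let $L\cong\mathcal{O}X$ be the corresponding continuous frame, equipped with the Scott topology and regarded as a localic semiring with addition $\vee$ and multiplication $\wedge$. Then the localic spectrum of $L$ is isomorphic to $X$ and hence coincides with the Hofmann--Lawson spectrum of $L$.
   Context: Everything is constructive. $\Omega$ is the frame of truth values; $\mathcal{O}X$ is the frame of opens of a locale $X$; $\oplus$ is coproduct of frames. In a dcpo, $a\ll b$ means that whenever $D$ is directed with $b\le\bigvee D$, there is $d\in D$ with $a\le d$. A dcpo is continuous if each $\{a\mid a\ll b\}$ is directed with supremum $b$. A frame is continuous if it is continuous as a dcpo; a locale $X$ is locally compact if $\mathcal{O}X$ is continuous, equivalently if $X$ is exponentiable in $\mathbf{Loc}$. The Scott topology on a dcpo consists of the upsets $U$ such that if $\bigvee D\in U$ with $D$ directed then $D\cap U$ is inhabited. A continuous frame $\mathcal{O}X$ with the Scott topology defines a spatial locale, isomorphic to the exponential $\mathbb{S}^X$ where $\mathbb{S}$ is the Sierpiński locale; it is a localic distributive lattice under $\vee$ and $\wedge$ and hence a localic semiring (zero being the least element $0$ and one being the top element). For a commutative localic semiring $R$, $\epsilon_0,\epsilon_1\colon\mathcal{O}R\to\Omega$ and $\mu_+,\mu_\times\colon\mathcal{O}R\to\mathcal{O}R\oplus\mathcal{O}R$ are the frame maps corresponding to zero, one, addition, multiplication; $\iota_1,\iota_2\colon\mathcal{O}R\to\mathcal{O}R\oplus\mathcal{O}R$ are the coproduct injections. $\mathrm{OPAI}_R\colon\mathbf{Loc}^{\mathrm{op}}\to\mathbf{Set}$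 sends $Y$ to the set of $u\in\mathcal{O}Y\oplus\mathcal{O}R$ with $(\mathcal{O}Y\oplus\epsilon_0)(u)=0$, $(\mathcal{O}Y\oplus\epsilon_1)(u)=1$, $(\mathcal{O}Y\oplus\mu_+)(u)\le(\mathcal{O}Y\oplus\iota_1)(u)\vee(\mathcal{O}Y\oplus\iota_2)(u)$, $(\mathcal{O}Y\oplus\mu_\times)(u)=(\mathcal{O}Y\oplus\iota_1)(u)\wedge(\mathcal{O}Y\oplus\iota_2)(u)$, a locale map $f$ acting by $f^*\oplus\mathcal{O}R$. The localic spectrum of $R$ is the representing object of $\mathrm{OPAI}_R$, when it exists. The (pointfree) Hofmann--Lawson spectrum of a continuous frame $L$ is the locale whose opens are the Scott-closed ideals of $L$ (ideals closed under directed joins, i.e. principal downsets), so that its frame of opens is isomorphic to $L$; its points are the Scott-open prime filters of $L$. *)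

(* Defs.v *)
(* Propositional and functional extensionality are the only axioms used; with
   them Prop plays the role of the frame of truth values and
   subsets, opens and frame maps can be compared with Leibniz equality. *)
From Stdlib Require Import ssreflect.
From Stdlib Require Import FunctionalExtensionality PropExtensionality.

Set Implicit Arguments.
Unset Strict Implicit.
Unset Printing Implicit Defensive.

Local Obligation Tactic := cbv beta.

Lemma pred_ext (A : Type) (P Q : A -> Prop) : (forall x, P x <-> Q x) -> P = Q.
Proof.
move=> PQ; apply: functional_extensionality => x.
exact: propositional_extensionality.
Qed.

Definition subset (A : Type) (P Q : A -> Prop) : Prop := forall x, P x -> Q x.

Definition image (A B : Type) (f : A -> B) (S : A -> Prop) : B -> Prop :=
  fun y => exists x, S x /\ y = f x.

Declare Scope frame_scope.
Delimit Scope frame_scope with F.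

Record Frame : Type := MkFrame {
  carrier :> Type;
  le : carrier -> carrier -> Prop;
  Sup : (carrier -> Prop) -> carrier;
  meet : carrier -> carrier -> carrier;
  le_refl : forall a, le a a;
  le_trans : forall a b c, le a b -> le b c -> le a c;
  le_antisym : forall a b, le a b -> le b a -> a = b;
  Sup_ub : forall (S : carrier -> Prop) a, S a -> le a (Sup S);
  Sup_least : forall (S : carrier -> Prop) b,
    (forall a, S a -> le a b) -> le (Sup S) b;
  meet_l : forall a b, le (meet a b) a;
  meet_r : forall a b, le (meet a b) b;
  meet_glb : forall a b c, le c a -> le c b -> le c (meet a b);
  meet_Sup : forall a (S : carrier -> Prop),
    le (meet a (Sup S)) (Sup (image (meet a) S)) }.

Notation "a <= b" := (le a b) : frame_scope.
Local Open Scope frame_scope.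

Definition top (L : Frame) : L := Sup (fun _ : L => True).
Definition bot (L : Frame) : L := Sup (fun _ : L => False).
Definition join (L : Frame) (a b : L) : L := Sup (fun x => x = a \/ x = b).
Arguments top {L}.
Arguments bot {L}.

Record Hom (L M : Frame) : Type := MkHom {
  hom_fun :> L -> M;
  hom_Sup : forall S, hom_fun (Sup S) = Sup (image hom_fun S);
  hom_meet : forall a b, hom_fun (meet a b) = meet (hom_fun a) (hom_fun b);
  hom_top : hom_fun top = top }.

Section FrameTheory.
Variable L : Frame.
Implicit Types a b c : L.

Lemma le_top a : a <= top. Proof. exact: Sup_ub. Qed.
Lemma bot_le a : bot <= a. Proof. by apply: Sup_least. Qed.
Lemma join_l a b : a <= join a b. Proof. by apply: Sup_ub; left. Qed.
Lemma join_r a b : b <= join a b. Proof. by apply: Sup_ub; right. Qed.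
Lemma join_lub a b c : a <= c -> b <= c -> join a b <= c.
Proof. by move=> ac bc; apply: Sup_least => x [->|->]. Qed.

Lemma Sup_le (S T : L -> Prop) :
  (forall a, S a -> exists b, T b /\ a <= b) -> Sup S <= Sup T.
Proof.
move=> ST; apply: Sup_least => a /ST [b [Tb ab]].
by apply: le_trans ab _; apply: Sup_ub.
Qed.

Lemma meet_mono a a' b b' : a <= a' -> b <= b' -> meet a b <= meet a' b'.
Proof.
move=> aa bb; apply: meet_glb; first by apply: le_trans (meet_l _ _) aa.
by apply: le_trans (meet_r _ _) bb.
Qed.

Lemma join_mono a a' b b' : a <= a' -> b <= b' -> join a b <= join a' b'.
Proof.
move=> aa bb; apply: join_lub; first by apply: le_trans aa (join_l _ _).
by apply: le_trans bb (join_r _ _).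
Qed.

Lemma meetC a b : meet a b = meet b a.
Proof.
by apply: le_antisym; apply: meet_glb; (apply: meet_l || apply: meet_r).
Qed.

Lemma Sup_meet a (S : L -> Prop) :
  meet (Sup S) a <= Sup (image (fun s => meet s a) S).
Proof.
rewrite meetC; apply: le_trans (meet_Sup _ _) _; apply: Sup_le => _ [s [Ss ->]].
by exists (meet s a); split; [exists s | rewrite meetC; apply: le_refl].
Qed.

Lemma meetA a b c : meet (meet a b) c = meet a (meet b c).
Proof.
apply: le_antisym; apply: meet_glb; try apply: meet_glb.
- by apply: le_trans (meet_l _ _) (meet_l _ _).
- by apply: le_trans (meet_l _ _) (meet_r _ _).
- exact: meet_r.
- exact: meet_l.
- by apply: le_trans (meet_r _ _) (meet_l _ _).
- by apply: le_trans (meet_r _ _) (meet_r _ _).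
Qed.

Lemma joinC a b : join a b = join b a.
Proof.
by apply: le_antisym; apply: join_lub; (apply: join_l || apply: join_r).
Qed.

Lemma joinA a b c : join (join a b) c = join a (join b c).
Proof.
apply: le_antisym; apply: join_lub; try apply: join_lub.
- exact: join_l.
- by apply: le_trans (join_r _ _); apply: join_l.
- by apply: le_trans (join_r _ _); apply: join_r.
- by apply: le_trans (join_l _ _); apply: join_l.
- by apply: le_trans (join_l _ _); apply: join_r.
- exact: join_r.
Qed.

Lemma join_bot a : join bot a = a.
Proof.
apply: le_antisym; last exact: join_r.
by apply: join_lub; [apply: bot_le | apply: le_refl].
Qed.

Lemma meet_top a : meet top a = a.
Proof.
apply: le_antisym; first exact: meet_r.
by apply: meet_glb; [apply: le_top | apply: le_refl].
Qed.

Lemma meet_bot a : meet bot a = bot.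
Proof. by apply: le_antisym; [apply: meet_l | apply: bot_le]. Qed.

Lemma meet_join a b c : meet a (join b c) = join (meet a b) (meet a c).
Proof.
apply: le_antisym.
  apply: le_trans (meet_Sup _ _) _; apply: Sup_least => _ [x [[->|->] ->]].
    exact: join_l.
  exact: join_r.
apply: join_lub; apply: meet_mono (le_refl _) _; [exact: join_l|exact: join_r].
Qed.

End FrameTheory.

Lemma hom_eq (L M : Frame) (f g : Hom L M) : (forall a, f a = g a) -> f = g.
Proof.
move: f g => [f f1 f2 f3] [g g1 g2 g3] /= fg.
have e : f = g by apply: functional_extensionality.
by subst g; congr MkHom; apply: proof_irrelevance.
Qed.

Lemma hom_mono (L M : Frame) (f : Hom L M) (a b : L) : a <= b -> f a <= f b.
Proof.
move=> ab; have e : a = meet a b.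
  by apply: le_antisym; [apply: meet_glb => //; apply: le_refl | apply: meet_l].
by rewrite e hom_meet; apply: meet_r.
Qed.

Lemma hom_bot (L M : Frame) (f : Hom L M) : f bot = bot.
Proof.
rewrite /bot hom_Sup; apply: le_antisym; last by apply: Sup_least.
by apply: Sup_least => a [x [[]]].
Qed.

Lemma hom_join (L M : Frame) (f : Hom L M) (a b : L) :
  f (join a b) = join (f a) (f b).
Proof.
apply: le_antisym; last first.
  by apply: join_lub; apply: hom_mono; [apply: join_l | apply: join_r].
rewrite hom_Sup; apply: Sup_least => _ [x [[->|->] ->]].
  exact: join_l.
exact: join_r.
Qed.

Program Definition idhom (L : Frame) : Hom L L := @MkHom L L (fun a => a) _ _ _.
Next Obligation.
move=> L S; congr Sup; apply: pred_ext => x; split; first by exists x.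
by case=> y [Sy ->].
Qed.
Next Obligation. by []. Qed.
Next Obligation. by []. Qed.

Program Definition comp (L M N : Frame) (g : Hom M N) (f : Hom L M) : Hom L N :=
  @MkHom L N (fun a => g (f a)) _ _ _.
Next Obligation.
move=> L M N g f S; rewrite !hom_Sup; congr Sup; apply: pred_ext => x; split.
  by case=> _ [[y [Sy ->]] ->]; exists y.
by case=> y [Sy ->]; exists (f y); split=> //; exists y.
Qed.
Next Obligation. by move=> L M N g f a b; rewrite !hom_meet. Qed.
Next Obligation. by move=> L M N g f; rewrite !hom_top. Qed.

Infix "\o" := comp (at level 50, left associativity) : frame_scope.

Record FrameIso (L M : Frame) : Type := MkFrameIso {
  iso_to : Hom L M;
  iso_from : Hom M L;
  iso_toK : iso_from \o iso_to = idhom L;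
  iso_fromK : iso_to \o iso_from = idhom M }.

Program Definition Omega : Frame :=
  @MkFrame Prop (fun p q => p -> q) (fun S => exists p, S p /\ p) and
    _ _ _ _ _ _ _ _ _.
Next Obligation. by []. Qed.
Next Obligation. by move=> a b c ab bc /ab. Qed.
Next Obligation. by move=> a b ab ba; apply: propositional_extensionality. Qed.
Next Obligation. by move=> S a Sa pa; exists a. Qed.
Next Obligation. by move=> S b H [a [Sa pa]]; apply: (H a). Qed.
Next Obligation. by move=> a b []. Qed.
Next Obligation. by move=> a b []. Qed.
Next Obligation. by move=> a b c ca cb pc; split; auto. Qed.
Next Obligation.
move=> a S [pa [b [Sb pb]]]; exists (a /\ b); split=> //; by exists b.
Qed.

(* The unique frame map from Omega, i.e. the map from a locale to the point. *)
Program Definition initial (L : Frame) : Hom Omega L :=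
  @MkHom Omega L (fun p : Prop => Sup (fun x : L => x = top /\ p)) _ _ _.
Next Obligation.
move=> L S; apply: le_antisym.
  apply: Sup_least => x [-> [p [Sp pp]]].
  apply: le_trans (Sup_ub (a := Sup (fun x : L => x = top /\ p)) _); last first.
    by exists p.
  by apply: Sup_ub.
apply: Sup_least => _ [p [Sp ->]]; apply: Sup_least => x [-> pp].
by apply: Sup_ub; split=> //; exists p.
Qed.
Next Obligation.
move=> L a b; apply: le_antisym.
  apply: Sup_least => x [-> [pa pb]].
  by apply: meet_glb; apply: Sup_ub.
apply: le_trans (meet_Sup _ _) _; apply: Sup_least => _ [x [[-> pb] ->]].
apply: le_trans (Sup_meet _ _) _; apply: Sup_least => _ [x' [[-> pa] ->]].
by rewrite meet_top; apply: Sup_ub.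
Qed.
Next Obligation.
move=> L; apply: le_antisym; first exact: le_top.
by apply: Sup_ub; split=> //; exists True.
Qed.

Lemma initial_unique (L : Frame) (f : Hom Omega L) : f = initial L.
Proof.
apply: hom_eq => p; have e : p = Sup (fun q : Omega => q = top /\ p).
  apply: propositional_extensionality; split.
    by move=> pp; exists (@top Omega); split=> //; exists True.
  by case=> q [[_ pp] _].
rewrite {1}e hom_Sup /=; congr Sup; apply: pred_ext => x; split.
  by case=> q [[-> pp] ->]; split=> //; apply: hom_top.
by case=> -> pp; exists (@top Omega); split=> //; rewrite hom_top.
Qed.

Section Coproduct.
Variables L M : Frame.

(* Taking S empty shows that a C-ideal contains (bot, b) and (a, bot). *)
Definition cideal (I : L -> M -> Prop) : Prop :=
  (forall a a' b b', a' <= a -> b' <= b -> I a b -> I a' b') /\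
  (forall S b, (forall a, S a -> I a b) -> I (Sup S) b) /\
  (forall a S, (forall b, S b -> I a b) -> I a (Sup S)).

Record coprod_carrier : Type := MkCoprod {
  cset :> L -> M -> Prop;
  csetP : cideal cset }.

Lemma coprod_eq (I J : coprod_carrier) :
  (forall a b, I a b <-> J a b) -> I = J.
Proof.
move: I J => [I HI] [J HJ] /= IJ.
have e : I = J.
  by apply: functional_extensionality => a; apply: pred_ext => b.
by subst J; congr MkCoprod; apply: proof_irrelevance.
Qed.

Lemma cset_down (I : coprod_carrier) a a' b b' :
  a' <= a -> b' <= b -> I a b -> I a' b'.
Proof. by case: (csetP I) => H _; apply: H. Qed.

Lemma cset_Supl (I : coprod_carrier) S b :
  (forall a, S a -> I a b) -> I (Sup S) b.
Proof. by case: (csetP I) => _ [H _]; apply: H. Qed.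

Lemma cset_Supr (I : coprod_carrier) a S :
  (forall b, S b -> I a b) -> I a (Sup S).
Proof. by case: (csetP I) => _ [_ H]; apply: H. Qed.

Program Definition cgen (G : L -> M -> Prop) : coprod_carrier :=
  @MkCoprod (fun a b => forall I : coprod_carrier,
    (forall x y, G x y -> I x y) -> I a b) _.
Next Obligation.
move=> G; split; [|split].
- by move=> a a' b b' aa bb H I GI; apply: cset_down aa bb (H I GI).
- by move=> S b H I GI; apply: cset_Supl => a Sa; apply: H.
- by move=> a S H I GI; apply: cset_Supr => b Sb; apply: H.
Qed.

(* Heyting implication in the coproduct; it gives frame distributivity. *)
Program Definition cimp (I J : coprod_carrier) : coprod_carrier :=
  @MkCoprod (fun a b => forall x y, I x y -> J (meet a x) (meet b y)) _.
Next Obligation.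
move=> I J; split; [|split].
- move=> a a' b b' aa bb H x y Ixy.
  apply: cset_down (H x y Ixy); exact: meet_mono (le_refl _).
- move=> S b H x y Ixy; apply: cset_down (Sup_meet _ _) (le_refl _) _.
  by apply: cset_Supl => _ [a [Sa ->]]; apply: H.
- move=> a S H x y Ixy; apply: cset_down (le_refl _) (Sup_meet _ _) _.
  by apply: cset_Supr => _ [b [Sb ->]]; apply: H.
Qed.

Program Definition cslice (x : L) (y : M) (J : coprod_carrier) : coprod_carrier :=
  @MkCoprod (fun a b => J (meet x a) (meet y b)) _.
Next Obligation.
move=> x y J; split; [|split].
- by move=> a a' b b' aa bb; apply: cset_down; apply: meet_mono (le_refl _) _.
- move=> S b H; apply: cset_down (meet_Sup _ _) (le_refl _) _.
  by apply: cset_Supl => _ [a [Sa ->]]; apply: H.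
- move=> a S H; apply: cset_down (le_refl _) (meet_Sup _ _) _.
  by apply: cset_Supr => _ [b [Sb ->]]; apply: H.
Qed.

Program Definition ccap (I J : coprod_carrier) : coprod_carrier :=
  @MkCoprod (fun a b => I a b /\ J a b) _.
Next Obligation.
move=> I J; split; [|split].
- by move=> a a' b b' aa bb [Ia Ja]; split; [apply: cset_down aa bb Ia | apply: cset_down aa bb Ja].
- by move=> S b H; split; apply: cset_Supl => a /H [].
- by move=> a S H; split; apply: cset_Supr => b /H [].
Qed.

Program Definition coprod : Frame :=
  @MkFrame coprod_carrier
    (fun I J => forall a b, I a b -> J a b)
    (fun S => cgen (fun a b => exists I, S I /\ I a b))
    ccap _ _ _ _ _ _ _ _ _.
Next Obligation. by []. Qed.
Next Obligation. by move=> I J K IJ JK a b /IJ /JK. Qed.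
Next Obligation. by move=> I J IJ JI; apply: coprod_eq => a b; split; auto. Qed.
Next Obligation. by move=> S I SI a b Iab J /(_ a b); apply; exists I. Qed.
Next Obligation.
move=> S J H a b /(_ J); apply=> x y [I [SI Ixy]]; exact: H Ixy.
Qed.
Next Obligation. by move=> I J a b []. Qed.
Next Obligation. by move=> I J a b []. Qed.
Next Obligation. by move=> I J K KI KJ a b Kab; split; auto. Qed.
Next Obligation.
move=> I S a b [Iab Sab] T HT.
have : cimp I T a b.
  apply: Sab => x y [J [SJ Jxy]] z w Izw; apply: HT.
  exists (ccap I J); split; first by exists J.
  split; first by apply: cset_down Izw; apply: meet_r.
  by apply: cset_down Jxy; apply: meet_l.
move=> /(_ a b Iab); apply: cset_down; apply: meet_glb; exact: le_refl.
Qed.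

Definition tensor (a : L) (b : M) : coprod := cgen (fun x y => x = a /\ y = b).

Lemma tensor_in a b : cset (tensor a b) a b.
Proof. by move=> I; apply. Qed.

Lemma tensor_le a b (I : coprod) : tensor a b <= I <-> cset I a b.
Proof.
split; first by move=> /(_ a b); apply; apply: tensor_in.
by move=> Iab x y /(_ I); apply=> _ _ [-> ->].
Qed.

Lemma tensor_mono a a' b b' : a <= a' -> b <= b' -> tensor a b <= tensor a' b'.
Proof.
by move=> aa bb; apply/tensor_le; apply: (cset_down aa bb); apply: tensor_in.
Qed.

Lemma tensor_meet a a' b b' :
  meet (tensor a b) (tensor a' b') = tensor (meet a a') (meet b b').
Proof.
apply: le_antisym; last first.
  by apply: meet_glb; apply: tensor_mono; (apply: meet_l || apply: meet_r).
set T := tensor (meet a a') _.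
have H' : tensor a' b' <= (cslice a b T : coprod).
  by apply/tensor_le; apply: tensor_in.
have H : tensor a b <= (cimp (tensor a' b') T : coprod).
  by apply/tensor_le => x y /H'.
move=> x y [xy xy']; move: (H _ _ xy _ _ xy').
by apply: cset_down; apply: meet_glb; exact: le_refl.
Qed.

Program Definition inl : Hom L coprod :=
  @MkHom L coprod (fun a => tensor a top) _ _ _.
Next Obligation.
move=> S; apply: le_antisym.
  apply/tensor_le; apply: cset_Supl => a Sa; apply/tensor_le.
  by apply: Sup_ub; exists a.
apply: Sup_least => _ [a [Sa ->]]; apply: tensor_mono; last exact: le_refl.
exact: Sup_ub.
Qed.
Next Obligation. by move=> a b; rewrite tensor_meet meet_top. Qed.
Next Obligation.
apply: le_antisym; first exact: le_top.
by move=> a b _; apply: (cset_down (le_top a) (le_top b)); apply: tensor_in.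
Qed.

Program Definition inr : Hom M coprod :=
  @MkHom M coprod (fun b => tensor top b) _ _ _.
Next Obligation.
move=> S; apply: le_antisym.
  apply/tensor_le; apply: cset_Supr => b Sb; apply/tensor_le.
  by apply: Sup_ub; exists b.
apply: Sup_least => _ [b [Sb ->]]; apply: tensor_mono; first exact: le_refl.
exact: Sup_ub.
Qed.
Next Obligation. by move=> a b; rewrite tensor_meet meet_top. Qed.
Next Obligation.
apply: le_antisym; first exact: le_top.
by move=> a b _; apply: (cset_down (le_top a) (le_top b)); apply: tensor_in.
Qed.

Lemma tensorE a b : tensor a b = meet (inl a) (inr b).
Proof.
have -> : meet (inl a) (inr b) = meet (tensor a top) (tensor top b) by [].
by rewrite tensor_meet meet_top meetC meet_top.
Qed.

Lemma coprodE (I : coprod) :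
  I = Sup (fun t => exists a b, cset I a b /\ t = tensor a b).
Proof.
apply: le_antisym.
  move=> a b Iab; apply/tensor_le; apply: Sup_ub; by exists a, b.
by apply: Sup_least => _ [a [b [Iab ->]]]; apply/tensor_le.
Qed.

Section Copair.
Variables (N : Frame) (f : Hom L N) (g : Hom M N).

Definition copair_fun (I : coprod) : N :=
  Sup (fun n => exists a b, cset I a b /\ n = meet (f a) (g b)).

Program Definition copair_adj (n : N) : coprod_carrier :=
  @MkCoprod (fun a b => meet (f a) (g b) <= n) _.
Next Obligation.
move=> n; split; [|split].
- move=> a a' b b' aa bb; apply: le_trans.
  by apply: meet_mono; apply: hom_mono.
- move=> S b H; rewrite hom_Sup; apply: le_trans (Sup_meet _ _) _.
  by apply: Sup_least => _ [_ [[a [Sa ->]] ->]]; apply: H.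
- move=> a S H; rewrite hom_Sup; apply: le_trans (meet_Sup _ _) _.
  by apply: Sup_least => _ [_ [[b [Sb ->]] ->]]; apply: H.
Qed.

Lemma copair_adjP (I : coprod) n :
  copair_fun I <= n <-> (I <= (copair_adj n : coprod)).
Proof.
split=> [H a b Iab | H].
  by apply: le_trans H; apply: Sup_ub; exists a, b.
by apply: Sup_least => _ [a [b [Iab ->]]]; apply: H.
Qed.

Program Definition copair : Hom coprod N := @MkHom coprod N copair_fun _ _ _.
Next Obligation.
move=> S; apply: le_antisym.
  apply/copair_adjP; apply: Sup_least => I SI; apply/copair_adjP.
  by apply: Sup_ub; exists I.
apply: Sup_least => _ [I [SI ->]]; apply/copair_adjP.
apply: le_trans (Sup_ub SI) _; apply/copair_adjP; exact: le_refl.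
Qed.
Next Obligation.
move=> I J; apply: le_antisym.
  apply: meet_glb; apply: Sup_least => _ [a [b [[Ia Ja] ->]]];
    by apply: Sup_ub; exists a, b.
apply: le_trans (meet_Sup _ _) _; apply: Sup_least => _ [_ [[a [b [Jab ->]]] ->]].
apply: le_trans (Sup_meet _ _) _; apply: Sup_least => _ [_ [[c [d [Icd ->]]] ->]].
apply: (@le_trans _ _ (meet (f (meet c a)) (g (meet d b)))).
  rewrite !hom_meet; apply: meet_glb; apply: meet_mono;
    (exact: meet_l || exact: meet_r).
apply: Sup_ub; exists (meet c a), (meet d b); split=> //; split.
  by apply: cset_down Icd; apply: meet_l.
by apply: cset_down Jab; apply: meet_r.
Qed.
Next Obligation.
apply: le_antisym; first exact: le_top.
apply: Sup_ub; exists top, top; split; last by rewrite !hom_top meet_top.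
have : tensor top top <= top by apply: le_top.
by move/tensor_le.
Qed.

Lemma copair_inl : copair \o inl = f.
Proof.
apply: hom_eq => a; apply: le_antisym.
  by apply/copair_adjP; apply/tensor_le; apply: meet_l.
apply: Sup_ub; exists a, top; split; first exact: tensor_in.
by rewrite hom_top meetC meet_top.
Qed.

Lemma copair_inr : copair \o inr = g.
Proof.
apply: hom_eq => b; apply: le_antisym.
  by apply/copair_adjP; apply/tensor_le; apply: meet_r.
apply: Sup_ub; exists top, b; split; first exact: tensor_in.
by rewrite hom_top meet_top.
Qed.

Lemma copair_unique (h : Hom coprod N) :
  h \o inl = f -> h \o inr = g -> h = copair.
Proof.
move=> hl hr; apply: hom_eq => I; rewrite {1}(coprodE I) hom_Sup.
congr Sup; apply: pred_ext => n; split.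
  case=> _ [[a [b [Iab ->]]] ->]; exists a, b; split=> //.
  by rewrite tensorE hom_meet -hl -hr.
case=> a [b [Iab ->]]; exists (tensor a b); split; first by exists a, b.
by rewrite tensorE hom_meet -hl -hr.
Qed.

End Copair.
End Coproduct.

Infix "(+)" := coprod (at level 50, left associativity) : frame_scope.
Arguments inl {L M}.
Arguments inr {L M}.

Lemma compA (K L M N : Frame) (h : Hom M N) (g : Hom L M) (f : Hom K L) :
  h \o (g \o f) = h \o g \o f.
Proof. exact: hom_eq. Qed.

Lemma comp_idl (L M : Frame) (f : Hom L M) : idhom M \o f = f.
Proof. exact: hom_eq. Qed.

Lemma comp_idr (L M : Frame) (f : Hom L M) : f \o idhom L = f.
Proof. exact: hom_eq. Qed.

Lemma comp_copair (L M N N' : Frame) (h : Hom N N') (f : Hom L N) (g : Hom M N) :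
  h \o copair f g = copair (h \o f) (h \o g).
Proof.
by apply: copair_unique; rewrite -compA ?copair_inl ?copair_inr.
Qed.

Definition coprod_map (L L' M M' : Frame) (f : Hom L L') (g : Hom M M') :
  Hom (L (+) M) (L' (+) M') := copair (inl \o f) (inr \o g).

Lemma coprod_map_comp (L L' L'' M M' M'' : Frame)
    (f' : Hom L' L'') (f : Hom L L') (g' : Hom M' M'') (g : Hom M M') :
  coprod_map f' g' \o coprod_map f g = coprod_map (f' \o f) (g' \o g).
Proof.
by rewrite /coprod_map comp_copair !compA copair_inl copair_inr.
Qed.

Lemma coprod_map_id (L M : Frame) :
  coprod_map (idhom L) (idhom M) = idhom (L (+) M).
Proof. by symmetry; apply: copair_unique; apply: hom_eq. Qed.

Record Locale : Type := MkLocale { O : Frame }.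

(* A map of locales Y -> X is a frame map O X -> O Y. *)
Definition LocMap (Y X : Locale) : Type := Hom (O X) (O Y).

Definition loc_id (X : Locale) : LocMap X X := idhom (O X).

Definition loc_comp (X Y Z : Locale) (g : LocMap Y Z) (f : LocMap X Y) :
  LocMap X Z := comp (L := O Z) (M := O Y) (N := O X) f g.

Definition loc_isomorphic (X Y : Locale) : Prop :=
  exists (f : LocMap X Y) (g : LocMap Y X),
    loc_comp g f = loc_id X /\ loc_comp f g = loc_id Y.

Record Presheaf : Type := MkPresheaf {
  psh_obj :> Locale -> Type;
  psh_map : forall Y Z, LocMap Y Z -> psh_obj Z -> psh_obj Y;
  psh_id : forall Y (u : psh_obj Y), psh_map (loc_id Y) u = u;
  psh_comp : forall X Y Z (f : LocMap X Y) (g : LocMap Y Z) (u : psh_obj Z),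
    psh_map (loc_comp g f) u = psh_map f (psh_map g u) }.

Record Representation (F : Presheaf) (S : Locale) : Type := MkRepresentation {
  rep_to : forall Y, LocMap Y S -> F Y;
  rep_from : forall Y, F Y -> LocMap Y S;
  rep_toK : forall Y (f : LocMap Y S), rep_from (rep_to f) = f;
  rep_fromK : forall Y (u : F Y), rep_to (rep_from u) = u;
  rep_natural : forall Y Z (f : LocMap Y Z) (g : LocMap Z S),
    rep_to (loc_comp g f) = psh_map f (rep_to g) }.

(* For frame maps x, y : OR -> N, seen as N-valued generalized points of R,
   the result of applying to them the operation given by mu. *)
Definition apply2 (R N : Frame) (mu : Hom R (R (+) R)) (x y : Hom R N) :
  Hom R N := copair x y \o mu.

(* The constant generalized point given by a global point. *)
Definition apply0 (R : Frame) (N : Frame) (eps : Hom R Omega) : Hom R N :=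
  initial N \o eps.

Definition gen1 (R : Frame) : Hom R (R (+) R (+) R) := inl \o inl.
Definition gen2 (R : Frame) : Hom R (R (+) R (+) R) := inl \o inr.
Definition gen3 (R : Frame) : Hom R (R (+) R (+) R) := inr.
Arguments gen1 {R}.
Arguments gen2 {R}.
Arguments gen3 {R}.

(* Each axiom is the usual commutative diagram, written as an equation between
   the generic points of R, of R * R or of R * R * R. *)
Record CommLocalicSemiring : Type := MkCLS {
  csr_loc :> Locale;
  eps0 : Hom (O csr_loc) Omega;
  eps1 : Hom (O csr_loc) Omega;
  mu_add : Hom (O csr_loc) (O csr_loc (+) O csr_loc);
  mu_mul : Hom (O csr_loc) (O csr_loc (+) O csr_loc);
  addA : apply2 mu_add (apply2 mu_add gen1 gen2) gen3
       = apply2 mu_add gen1 (apply2 mu_add gen2 gen3);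
  addC : apply2 mu_add inl inr = apply2 mu_add inr inl;
  add0 : apply2 mu_add (apply0 (O csr_loc) eps0) (idhom _) = idhom _;
  mulA : apply2 mu_mul (apply2 mu_mul gen1 gen2) gen3
       = apply2 mu_mul gen1 (apply2 mu_mul gen2 gen3);
  mulC : apply2 mu_mul inl inr = apply2 mu_mul inr inl;
  mul1 : apply2 mu_mul (apply0 (O csr_loc) eps1) (idhom _) = idhom _;
  mulDr : apply2 mu_mul gen1 (apply2 mu_add gen2 gen3)
        = apply2 mu_add (apply2 mu_mul gen1 gen2) (apply2 mu_mul gen1 gen3);
  mul0 : apply2 mu_mul (apply0 (O csr_loc) eps0) (idhom _)
       = apply0 (O csr_loc) eps0 }.

Section OPAI.
Variable R : CommLocalicSemiring.
Let OR : Frame := O R.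

(* oY f is O Y (+) f. *)
Definition is_opai (Y : Locale) (u : O Y (+) OR) : Prop :=
  let oY (M N : Frame) (f : Hom M N) := coprod_map (idhom (O Y)) f in
  oY _ _ (eps0 R) u = bot /\
  oY _ _ (eps1 R) u = top /\
  oY _ _ (mu_add R) u <= join (oY _ _ inl u) (oY _ _ inr u) /\
  oY _ _ (mu_mul R) u = meet (oY _ _ inl u) (oY _ _ inr u).

Definition opai_obj (Y : Locale) : Type := {u : O Y (+) OR | is_opai u}.

Lemma opai_eq (Y : Locale) (u v : opai_obj Y) : proj1_sig u = proj1_sig v -> u = v.
Proof.
move: u v => [u hu] [v hv] /= e; subst v.
by congr exist; apply: proof_irrelevance.
Qed.

Lemma opai_pullback (Y Z : Locale) (f : LocMap Y Z) (u : O Z (+) OR) :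
  is_opai u -> is_opai (Y := Y) (coprod_map (f : Hom (O Z) (O Y)) (idhom OR) u).
Proof.
have swap M (g : Hom OR M) :
    coprod_map (idhom (O Y)) g (coprod_map (f : Hom (O Z) (O Y)) (idhom OR) u)
    = coprod_map (f : Hom (O Z) (O Y)) (idhom M) (coprod_map (idhom (O Z)) g u).
  have := coprod_map_comp (idhom (O Y)) f g (idhom OR).
  have := coprod_map_comp f (idhom (O Z)) (idhom M) g.
  rewrite !comp_idl !comp_idr => <- e.
  exact: (f_equal (fun h : Hom _ _ => h u) e).
case=> [H0 [H1 [H2 H3]]]; split; [|split; [|split]]; rewrite !swap.
- by rewrite H0 hom_bot.
- by rewrite H1 hom_top.
- by rewrite -hom_join; apply: hom_mono.
- by rewrite -hom_meet H3.
Qed.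

Definition opai_map (Y Z : Locale) (f : LocMap Y Z) (u : opai_obj Z) :
  opai_obj Y := exist _ _ (opai_pullback f (proj2_sig u)).

Program Definition OPAI : Presheaf := @MkPresheaf opai_obj opai_map _ _.
Next Obligation.
move=> Y u; apply: opai_eq.
exact: (f_equal (fun h : Hom _ _ => h (proj1_sig u)) (coprod_map_id (O Y) OR)).
Qed.
Next Obligation.
move=> X Y Z f g u; apply: opai_eq => /=.
have := coprod_map_comp (f : Hom (O Y) (O X)) (g : Hom (O Z) (O Y))
  (idhom OR) (idhom OR).
by rewrite comp_idl => /(f_equal (fun h : Hom _ _ => h (proj1_sig u))).
Qed.

Definition is_localic_spectrum (S : Locale) : Prop :=
  inhabited (Representation OPAI S).

End OPAI.

Section Scott.
Variable L : Frame.

Definition directed (D : L -> Prop) : Prop :=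
  (exists d, D d) /\
  (forall a b, D a -> D b -> exists c, D c /\ a <= c /\ b <= c).

(* A frame has all joins, so the joins of directed sets required of a dcpo are
   given by Sup. *)
Definition way_below (a b : L) : Prop :=
  forall D, directed D -> b <= Sup D -> exists d, D d /\ a <= d.

Definition continuous : Prop :=
  forall b, directed (fun a => way_below a b) /\
            Sup (fun a => way_below a b) = b.

Definition scott_open (U : L -> Prop) : Prop :=
  (forall a b, a <= b -> U a -> U b) /\
  (forall D, directed D -> U (Sup D) -> exists d, D d /\ U d).

Record scott_open_set : Type := MkScottOpen {
  sset :> L -> Prop;
  ssetP : scott_open sset }.

Lemma scott_open_eq (U V : scott_open_set) : (forall a, U a <-> V a) -> U = V.
Proof.
move: U V => [U hU] [V hV] /= /pred_ext e; subst V.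
by congr MkScottOpen; apply: proof_irrelevance.
Qed.

Program Definition scott_union (S : scott_open_set -> Prop) : scott_open_set :=
  @MkScottOpen (fun a => exists U : scott_open_set, S U /\ U a) _.
Next Obligation.
move=> S; split.
  move=> a b ab [U [SU Ua]]; exists U; split=> //.
  by case: (ssetP U) => H _; apply: H ab Ua.
move=> D dD [U [SU /(proj2 (ssetP U) D dD) [d [Dd Ud]]]].
by exists d; split=> //; exists U.
Qed.

Program Definition scott_inter (U V : scott_open_set) : scott_open_set :=
  @MkScottOpen (fun a => U a /\ V a) _.
Next Obligation.
move=> U V; split.
  move=> a b ab [Ua Va].
  by split; [apply: (proj1 (ssetP U)) Ua | apply: (proj1 (ssetP V)) Va].
move=> D dD [/(proj2 (ssetP U) D dD) [d [Dd Ud]]].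
move=> /(proj2 (ssetP V) D dD) [e [De Ve]].
case: (dD) => _ /(_ d e Dd De) [c [Dc [dc ec]]]; exists c; split=> //.
by split; [apply: (proj1 (ssetP U)) Ud | apply: (proj1 (ssetP V)) Ve].
Qed.

Program Definition scott_topology : Frame :=
  @MkFrame scott_open_set (fun U V => subset U V) scott_union scott_inter
    _ _ _ _ _ _ _ _ _.
Next Obligation. by move=> U a. Qed.
Next Obligation. by move=> U V W UV VW a /UV /VW. Qed.
Next Obligation. by move=> U V UV VU; apply: scott_open_eq => a; split; auto. Qed.
Next Obligation. by move=> S U SU a Ua; exists U. Qed.
Next Obligation. by move=> S V H a [U [SU Ua]]; apply: (H U). Qed.
Next Obligation. by move=> U V a []. Qed.
Next Obligation. by move=> U V a []. Qed.
Next Obligation. by move=> U V W WU WV a Wa; split; auto. Qed.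
Next Obligation.
move=> U S a [Ua [V [SV Va]]]; exists (scott_inter U V); split=> //.
by exists V.
Qed.

Program Definition scott_point (a : L) : Hom scott_topology Omega :=
  @MkHom scott_topology Omega (fun U : scott_open_set => U a) _ _ _.
Next Obligation.
move=> a S; apply: propositional_extensionality; split.
  by case=> U [SU Ua]; exists (U a); split=> //; exists U.
by case=> _ [[U [SU ->]] Ua]; exists U.
Qed.
Next Obligation. by []. Qed.
Next Obligation.
move=> a; apply: propositional_extensionality; split; first by exists True.
move=> _; have h : scott_open (fun _ : L => True).
  by split=> // D [[d Dd] _] _; exists d.
by exists (MkScottOpen h).
Qed.

End Scott.

(* Two frame maps into N agree as soon as they agree at the points of such a
   base; this is how the semiring axioms of the Scott topology are checked.
   A base is a family of points of N together with, for each point p, an open nbd p that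
   is contained in every open containing p, such that every open is the union
   of the nbd p over the points p that it contains. *)
Record PointBase (N : Frame) : Type := MkPointBase {
  pb_idx : Type;
  pb_pt : pb_idx -> Hom N Omega;
  pb_nbd : pb_idx -> N;
  pb_nbd_le : forall p u, pb_pt p u -> pb_nbd p <= u;
  pb_cover : forall u, u <= Sup (fun v => exists p, pb_pt p u /\ v = pb_nbd p) }.

Lemma pb_ext (M N : Frame) (B : PointBase N) (f g : Hom M N) :
  (forall p : pb_idx B, pb_pt p \o f = pb_pt p \o g) -> f = g.
Proof.
move=> H; apply: hom_eq => a.
have H' (p : pb_idx B) : pb_pt p (f a) = pb_pt p (g a).
  exact: (f_equal (fun h : Hom _ _ => h a) (H p)).
apply: le_antisym; apply: le_trans (pb_cover B _) _;
  apply: Sup_least => _ [p [pa ->]]; apply: pb_nbd_le.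
  by rewrite -H'.
by rewrite H'.
Qed.

Program Definition pb_coprod (M N : Frame) (B : PointBase M) (C : PointBase N) :
    PointBase (M (+) N) :=
  @MkPointBase (M (+) N) (pb_idx B * pb_idx C)
    (fun p => copair (pb_pt (fst p)) (pb_pt (snd p)))
    (fun p => tensor (pb_nbd (fst p)) (pb_nbd (snd p))) _ _.
Next Obligation.
move=> M N B C [p q] u /= [_ [[a [b [uab ->]]] [pa qb]]].
by apply/tensor_le; apply: cset_down uab; apply: pb_nbd_le.
Qed.
Next Obligation.
move=> M N B C u a b uab.
set T := Sup _; apply: (cset_down (I := T) (pb_cover B a) (le_refl b)).
apply: cset_Supl => _ [p [pa ->]].
apply: (cset_down (I := T) (le_refl _) (pb_cover C b)).
apply: cset_Supr => _ [q [qb ->]]; apply/tensor_le.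
apply: Sup_ub; exists (p, q); split=> //=.
by exists (pb_pt p a /\ pb_pt q b); split=> //; exists a, b.
Qed.

Section ContinuousFrame.
Variable L : Frame.
Hypothesis contL : continuous L.

Lemma wb_le (a b : L) : way_below a b -> a <= b.
Proof.
move=> /(_ (fun x => x = b)) [].
- by split; [exists b | move=> x y -> ->; exists b; split=> //; split; apply: le_refl].
- exact: Sup_ub.
- by move=> _ [-> ].
Qed.

Lemma wb_trans (a a' b b' : L) : a <= a' -> way_below a' b' -> b' <= b ->
  way_below a b.
Proof.
move=> aa ab bb D dD bD; case: (ab D dD (le_trans bb bD)) => d [Dd ad].
by exists d; split=> //; apply: le_trans ad.
Qed.

Lemma wb_interp (a b : L) : way_below a b ->
  exists c, way_below a c /\ way_below c b.
Proof.
move=> ab.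
have [d [[c [dc cb]] ad]] : exists d,
    (exists c, way_below d c /\ way_below c b) /\ a <= d; last first.
  by exists c; split=> //; apply: wb_trans ad dc (le_refl _).
apply: ab; last first.
  rewrite -{1}(proj2 (contL b)); apply: Sup_least => c cb.
  rewrite -(proj2 (contL c)); apply: Sup_least => d dc.
  by apply: Sup_ub; exists c.
have [[c cb] dirb] := proj1 (contL b); split.
  by have [[d dc] _] := proj1 (contL c); exists d, c.
move=> d d' [e [de eb]] [e' [de' eb']].
have [f [fb [ef ef']]] := dirb e e' eb eb'.
have df := wb_trans (le_refl _) de ef; have df' := wb_trans (le_refl _) de' ef'.
have [g [gf gg]] := proj2 (proj1 (contL f)) d d' df df'.
by exists g; split=> //; exists f.
Qed.

Lemma way_up_open (a : L) : scott_open (fun b => way_below a b).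
Proof.
split; first by move=> b c bc ab; apply: wb_trans (le_refl _) ab bc.
move=> D dD /wb_interp [c [ac cD]].
case: (cD D dD (le_refl _)) => d [Dd cd]; exists d; split=> //.
exact: wb_trans (le_refl _) ac cd.
Qed.

Definition way_up (a : L) : scott_topology L := MkScottOpen (way_up_open a).

Lemma scott_approx (U : scott_open_set L) (a : L) : U a ->
  exists b, way_below b a /\ U b.
Proof.
move=> Ua; apply: (proj2 (ssetP U)); first exact: (proj1 (contL a)).
by rewrite (proj2 (contL a)).
Qed.

Lemma way_up_le (U : scott_open_set L) (a : L) : U a -> subset (way_up a) U.
Proof. by move=> Ua b /wb_le ab; apply: (proj1 (ssetP U)) ab Ua. Qed.

Program Definition scott_base : PointBase (scott_topology L) :=
  @MkPointBase (scott_topology L) L (@scott_point L) way_up _ _.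
Next Obligation. by move=> a U; apply: way_up_le. Qed.
Next Obligation.
move=> U a /scott_approx [b [ba Ub]]; exists (way_up b); split=> //.
by exists b.
Qed.

Section Operation.
Variable op : L -> L -> L.
Hypothesis op_mono : forall a a' b b', a <= a' -> b <= b' -> op a b <= op a' b'.
Hypothesis op_Sup : forall D E, directed D -> directed E ->
  op (Sup D) (Sup E) <= Sup (fun c => exists d e, D d /\ E e /\ c = op d e).

Program Definition scott_op_fun (U : scott_topology L) :
    scott_topology L (+) scott_topology L :=
  @MkCoprod (scott_topology L) (scott_topology L)
    (fun V W => forall a b, sset V a -> sset W b -> sset U (op a b)) _.
Next Obligation.
move=> U; split; [|split].
- by move=> V V' W W' VV WW H a b /VV Va /WW Wb; apply: H.
- by move=> S W H a b [V [SV Va]] Wb; apply: (H V).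
- by move=> V S H a b Va [W [SW Wb]]; apply: (H W).
Qed.

(* The inverse image map of op : L * L -> L for the Scott topology; its value
   at U is the join of all V (x) W with V x W included in op^-1 U. *)
Program Definition scott_op :
    Hom (scott_topology L) (scott_topology L (+) scott_topology L) :=
  @MkHom _ _ scott_op_fun _ _ _.
Next Obligation.
move=> S; apply: le_antisym; last first.
  apply: Sup_least => _ [U [SU ->]] V W H a b Va Wb.
  by exists U; split=> //; apply: H.
move=> V W H; set T := Sup _.
apply: (cset_down (I := T) (pb_cover scott_base V) (le_refl W)).
apply: cset_Supl => _ [a [Va ->]].
apply: (cset_down (I := T) (le_refl _) (pb_cover scott_base W)).
apply: cset_Supr => _ [b [Wb ->]].
case: (H a b Va Wb) => U [SU Uab].
have le_T : scott_op_fun U <= T by apply: Sup_ub; exists U.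
apply: le_T => c d /wb_le ac /wb_le bd.
by apply: (proj1 (ssetP U)) Uab; apply: op_mono.
Qed.
Next Obligation.
move=> U U'; apply: coprod_eq => V W; split.
  by move=> H; split=> a b Va Wb; case: (H a b Va Wb).
by case=> H H' a b Va Wb; split; [apply: H | apply: H'].
Qed.
Next Obligation.
apply: le_antisym; first exact: le_top.
move=> V W _ a b _ _.
have -> : sset (@top (scott_topology L)) (op a b) = scott_point (op a b) top by [].
by rewrite hom_top; exists True.
Qed.

Lemma scott_op_point (a b : L) :
  apply2 scott_op (scott_point a) (scott_point b) = scott_point (op a b).
Proof.
apply: hom_eq => U; apply: propositional_extensionality; split.
  by case=> _ [[V [W [H ->]]] [Va Wb]]; apply: H.
move=> /= Uab.
have [c [[a' [b' [a'a [b'b ->]]]] Uc]] : exists c,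
    (exists a' b', way_below a' a /\ way_below b' b /\ c = op a' b') /\ sset U c.
  have [[[x xa] dira] Ea] := contL a; have [[[y yb] dirb] Eb] := contL b.
  apply: (proj2 (ssetP U)).
    split; first by exists (op x y), x, y.
    move=> _ _ [a1 [b1 [a1a [b1b ->]]]] [a2 [b2 [a2a [b2b ->]]]].
    have [a3 [a3a [a13 a23]]] := dira a1 a2 a1a a2a.
    have [b3 [b3b [b13 b23]]] := dirb b1 b2 b1b b2b.
    exists (op a3 b3); split; first by exists a3, b3.
    by split; apply: op_mono.
  apply: (proj1 (ssetP U)) Uab; rewrite -{1}Ea -{1}Eb.
  by apply: op_Sup; [apply: (proj1 (contL a)) | apply: (proj1 (contL b))].
exists (way_below a' a /\ way_below b' b); split=> //.
exists (way_up a'), (way_up b'); split=> // x y /wb_le ax /wb_le by_.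
by apply: (proj1 (ssetP U)) Uc; apply: op_mono.
Qed.

End Operation.

Lemma join_Sup_directed (D E : L -> Prop) : directed D -> directed E ->
  join (Sup D) (Sup E) <= Sup (fun c => exists d e, D d /\ E e /\ c = join d e).
Proof.
move=> [[d0 Dd0] _] [[e0 Ee0] _]; apply: join_lub; apply: Sup_least.
  move=> d Dd; apply: le_trans (join_l d e0) _.
  by apply: Sup_ub; exists d, e0.
move=> e Ee; apply: le_trans (join_r d0 e) _.
by apply: Sup_ub; exists d0, e.
Qed.

Lemma meet_Sup_directed (D E : L -> Prop) : directed D -> directed E ->
  meet (Sup D) (Sup E) <= Sup (fun c => exists d e, D d /\ E e /\ c = meet d e).
Proof.
move=> _ _; apply: le_trans (meet_Sup _ _) _; apply: Sup_least => _ [e [Ee ->]].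
apply: le_trans (Sup_meet _ _) _; apply: Sup_least => _ [d [Dd ->]].
by apply: Sup_ub; exists d, e.
Qed.

Definition scott_join := scott_op (@join_mono L).
Definition scott_meet := scott_op (@meet_mono L).

Lemma scott_join_point (a b : L) :
  apply2 scott_join (scott_point a) (scott_point b) = scott_point (join a b).
Proof. exact: scott_op_point join_Sup_directed _ _. Qed.

Lemma scott_meet_point (a b : L) :
  apply2 scott_meet (scott_point a) (scott_point b) = scott_point (meet a b).
Proof. exact: scott_op_point meet_Sup_directed _ _. Qed.

Lemma comp_apply2 (R N N' : Frame) (mu : Hom R (R (+) R)) (h : Hom N N')
  (x y : Hom R N) : h \o apply2 mu x y = apply2 mu (h \o x) (h \o y).
Proof. by rewrite /apply2 compA comp_copair. Qed.

Lemma comp_apply0 (R N : Frame) (eps : Hom R Omega) (h : Hom N Omega) :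
  h \o apply0 N eps = eps.
Proof.
by rewrite /apply0 compA (initial_unique (h \o _))
  -(initial_unique (idhom _)) comp_idl.
Qed.

Let base2 := pb_coprod scott_base scott_base.
Let base3 := pb_coprod base2 scott_base.

Let pointE :=
  (comp_apply2, comp_apply0, copair_inl, copair_inr, comp_idr, compA,
   scott_join_point, scott_meet_point).

Definition scott_semiring : CommLocalicSemiring.
Proof.
apply: (@MkCLS (MkLocale (scott_topology L)) (scott_point bot)
  (scott_point top) scott_join scott_meet).
- apply: (pb_ext (B := base3)) => - [[a b] c]; rewrite /gen1 /gen2 /gen3 /=.
  by rewrite !pointE joinA.
- apply: (pb_ext (B := base2)) => - [a b] /=.
  by rewrite !pointE joinC.
- apply: (pb_ext (B := scott_base)) => a /=.
  by rewrite !pointE join_bot.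
- apply: (pb_ext (B := base3)) => - [[a b] c]; rewrite /gen1 /gen2 /gen3 /=.
  by rewrite !pointE meetA.
- apply: (pb_ext (B := base2)) => - [a b] /=.
  by rewrite !pointE meetC.
- apply: (pb_ext (B := scott_base)) => a /=.
  by rewrite !pointE meet_top.
- apply: (pb_ext (B := base3)) => - [[a b] c]; rewrite /gen1 /gen2 /gen3 /=.
  by rewrite !pointE meet_join.
- apply: (pb_ext (B := scott_base)) => a /=.
  by rewrite !pointE meet_bot.
Defined.

End ContinuousFrame.

Definition locally_compact (X : Locale) : Prop := continuous (O X).

Section ContinuousIso.
Variables (L M : Frame) (e : FrameIso L M).

Lemma iso_toE (a : L) : iso_from e (iso_to e a) = a.
Proof. exact: (f_equal (fun h : Hom _ _ => h a) (iso_toK e)). Qed.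

Lemma iso_fromE (b : M) : iso_to e (iso_from e b) = b.
Proof. exact: (f_equal (fun h : Hom _ _ => h b) (iso_fromK e)). Qed.

End ContinuousIso.

Definition iso_sym (L M : Frame) (e : FrameIso L M) : FrameIso M L :=
  MkFrameIso (iso_fromK e) (iso_toK e).

Lemma directed_image (L M : Frame) (f : Hom L M) (D : L -> Prop) :
  directed D -> directed (image f D).
Proof.
move=> [[d Dd] dirD]; split; first by exists (f d), d.
move=> _ _ [a [Da ->]] [b [Db ->]].
have [c [Dc [ac bc]]] := dirD a b Da Db; exists (f c); split; first by exists c.
by split; apply: hom_mono.
Qed.

Lemma iso_way_below (L M : Frame) (e : FrameIso L M) (a b : L) :
  way_below a b -> way_below (iso_to e a) (iso_to e b).
Proof.
move=> ab D dD bD.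
case: (ab (image (iso_from e) D)).
- exact: directed_image.
- by rewrite -hom_Sup -(iso_toE e b); apply: hom_mono.
- move=> _ [[d [Dd ->]] ad]; exists d; split=> //.
  by rewrite -(iso_fromE e d); apply: hom_mono.
Qed.

Lemma continuous_iso (L M : Frame) (e : FrameIso L M) :
  continuous M -> continuous L.
Proof.
move=> contM b; have [dM EM] := contM (iso_to e b).
have E : (fun a => way_below a b)
       = image (iso_from e) (fun a => way_below a (iso_to e b)).
  apply: pred_ext => a; split.
    move=> ab; exists (iso_to e a); split; last by rewrite iso_toE.
    exact: iso_way_below.
  by case=> c [cb ->]; have := iso_way_below (e := iso_sym e) cb; rewrite /= iso_toE.
rewrite E; split; first exact: directed_image.
by rewrite -hom_Sup EM iso_toE.
Qed.

Section HofmannLawson.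
Variable L : Frame.

Definition ideal (I : L -> Prop) : Prop :=
  I bot /\
  (forall a b, a <= b -> I b -> I a) /\
  (forall a b, I a -> I b -> I (join a b)).

Definition scott_closed_ideal (I : L -> Prop) : Prop :=
  ideal I /\ (forall D, directed D -> subset D I -> I (Sup D)).

Record sc_ideal : Type := MkScIdeal {
  iset :> L -> Prop;
  isetP : scott_closed_ideal iset }.

Lemma sc_ideal_eq (I J : sc_ideal) : (forall a, I a <-> J a) -> I = J.
Proof.
move: I J => [I hI] [J hJ] /= /pred_ext e; subst J.
by congr MkScIdeal; apply: proof_irrelevance.
Qed.

Lemma sc_ideal_down (I : sc_ideal) a b : a <= b -> I b -> I a.
Proof. by case: (isetP I) => [[_ [H _]] _]; apply: H. Qed.

Lemma sc_ideal_Sup (I : sc_ideal) : I (Sup I).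
Proof.
case: (isetP I) => [[I0 [_ Ij]] Id]; apply: Id => //.
split; first by exists bot.
move=> a b Ia Ib; exists (join a b); split; first exact: Ij.
by split; [apply: join_l | apply: join_r].
Qed.

Program Definition principal (a : L) : sc_ideal :=
  @MkScIdeal (fun x => x <= a) _.
Next Obligation.
move=> a; split; last by move=> D _; apply: Sup_least.
split; first exact: bot_le.
by split; [move=> x y; apply: le_trans | move=> x y; apply: join_lub].
Qed.

Program Definition sc_ideal_inter (I J : sc_ideal) : sc_ideal :=
  @MkScIdeal (fun a => I a /\ J a) _.
Next Obligation.
move=> I J; case: (isetP I) => [[I0 [Il Ij]] Id].
case: (isetP J) => [[J0 [Jl Jj]] Jd]; split; last first.
  by move=> D dD H; split; [apply: Id | apply: Jd] => // x /H [].
split=> //; split; first by move=> a b ab [Ib Jb]; split; eauto.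
by move=> a b [Ia Ja] [Ib Jb]; split; auto.
Qed.

Program Definition sc_ideal_frame : Frame :=
  @MkFrame sc_ideal (fun I J => subset I J)
    (fun S => principal (Sup (fun a => exists I : sc_ideal, S I /\ I a)))
    sc_ideal_inter _ _ _ _ _ _ _ _ _.
Next Obligation. by move=> I a. Qed.
Next Obligation. by move=> I J K IJ JK a /IJ /JK. Qed.
Next Obligation. by move=> I J IJ JI; apply: sc_ideal_eq => a; split; auto. Qed.
Next Obligation. by move=> S I SI a Ia; apply: Sup_ub; exists I. Qed.
Next Obligation.
move=> S J H a /= aS; apply: sc_ideal_down (sc_ideal_Sup J).
apply: le_trans aS _; apply: Sup_least => x [I [SI Ix]].
by apply: Sup_ub; apply: (H I).
Qed.
Next Obligation. by move=> I J a []. Qed.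
Next Obligation. by move=> I J a []. Qed.
Next Obligation. by move=> I J K KI KJ a Ka; split; auto. Qed.
Next Obligation.
move=> I S a [Ia /= aS].
apply: le_trans (meet_glb (le_refl a) aS) _.
apply: le_trans (meet_Sup _ _) _; apply: Sup_least => _ [x [[J [SJ Jx]] ->]].
apply: Sup_ub; exists (sc_ideal_inter I J); split; first by exists J.
by split; [apply: sc_ideal_down Ia; apply: meet_l
          | apply: sc_ideal_down Jx; apply: meet_r].
Qed.

Definition hofmann_lawson_spectrum : Locale := MkLocale sc_ideal_frame.

End HofmannLawson.

(* Main.v *)
(* Since the Scott opens of a continuous frame L are unions of the sets
   {b | a << b}, an element u of O Y (+) O R is determined by its fibres
   phi a : O Y over the points a of L, and the functions phi : L -> O Y that
   arise are exactly the Scott continuous ones.  The four conditions defining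
   an open prime anti-ideal, read fibrewise, say that phi preserves finite joins
   and finite meets, so that phi is a frame map L -> O Y, i.e. a locale map
   from Y to the locale with frame of opens L.  That locale thus represents
   OPAI, and every other spectrum is isomorphic to it by Yoneda. *)
Require Import Defs.
From Stdlib Require Import ssreflect.

Set Implicit Arguments.
Unset Strict Implicit.
Unset Printing Implicit Defensive.

Local Open Scope frame_scope.
Local Obligation Tactic := cbv beta.

(** * Isomorphic locales and uniqueness of representing objects *)

Lemma loc_isomorphic_trans (X Y Z : Locale) :
  loc_isomorphic X Y -> loc_isomorphic Y Z -> loc_isomorphic X Z.
Proof.
case=> [f [g [gf fg]]] [f' [g' [gf' fg']]].
have ptw (V W : Locale) (h : LocMap V W) (k : LocMap W V) :
    loc_comp k h = loc_id V -> forall v : O V, h (k v) = v.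
  by move=> e v; exact: (f_equal (fun l : Hom _ _ => l v) e).
exists (loc_comp f' f), (loc_comp g g'); split; apply: hom_eq => x /=.
  by rewrite (ptw _ _ _ _ gf') (ptw _ _ _ _ gf).
by rewrite (ptw _ _ _ _ fg) (ptw _ _ _ _ fg').
Qed.

Lemma frame_iso_loc (L M : Frame) :
  FrameIso L M -> loc_isomorphic (MkLocale L) (MkLocale M).
Proof. by move=> [f g gf fg]; exists g, f. Qed.

Lemma representation_unique (F : Presheaf) (S T : Locale) :
  Representation F S -> Representation F T -> loc_isomorphic S T.
Proof.
move=> r s.
have key (S' T' : Locale) (r' : Representation F S') (s' : Representation F T') :
    loc_comp (rep_from r' (rep_to s' (loc_id T')))
             (rep_from s' (rep_to r' (loc_id S'))) = loc_id S'.
  (* Maps into [S'] are compared through their images in [F]; naturality of [r'] and then of [s']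
     carries the composite to the generic element [rep_to r' (loc_id S')]. *)
  rewrite -[LHS](rep_toK r') rep_natural rep_fromK -rep_natural.
  have idl (f : LocMap S' T') : loc_comp (loc_id T') f = f by apply: hom_eq.
  by rewrite idl rep_fromK rep_toK.
exists (rep_from s (rep_to r (loc_id S))), (rep_from r (rep_to s (loc_id T))).
by split; apply: key.
Qed.

(** * The Hofmann-Lawson frame as a copy of [L] *)

(** An ideal is directed, so closure under directed joins puts its own supremum in it. *)
Lemma sc_ideal_principal (L : Frame) (I : sc_ideal L) : principal (Sup I) = I.
Proof.
apply: sc_ideal_eq => a; split=> [/= aI | Ia]; last exact: Sup_ub.
exact: sc_ideal_down aI (sc_ideal_Sup I).
Qed.

Lemma Sup_principal (L : Frame) (a : L) : Sup (principal a) = a.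
Proof.
by apply: le_antisym; [apply: Sup_least | apply: Sup_ub; apply: le_refl].
Qed.

Program Definition principal_hom (L : Frame) : Hom L (sc_ideal_frame L) :=
  @MkHom L (sc_ideal_frame L) (@principal L) _ _ _.
Next Obligation.
move=> L S; rewrite -[RHS]sc_ideal_principal; congr principal.
apply: le_antisym; last first.
  apply: Sup_least => a /= aS; apply: le_trans aS _.
  apply: Sup_least => b [_ [[c [Sc ->]] /= bc]].
  by apply: le_trans bc _; apply: Sup_ub.
apply: Sup_least => a Sa; apply: Sup_ub => /=; apply: Sup_ub.
by exists (principal a); split; [exists a | apply: le_refl].
Qed.
Next Obligation.
move=> L a b; apply: sc_ideal_eq => c; split; last by case; apply: meet_glb.
by move=> /= cab; split; apply: le_trans cab _; [apply: meet_l | apply: meet_r].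
Qed.
Next Obligation.
move=> L; apply: le_antisym; first exact: le_top.
by move=> a _; apply: le_top.
Qed.

Program Definition ideal_Sup_hom (L : Frame) : Hom (sc_ideal_frame L) L :=
  @MkHom (sc_ideal_frame L) L (fun I => Sup (iset I)) _ _ _.
Next Obligation.
move=> L S; rewrite Sup_principal; apply: le_antisym.
  apply: Sup_least => a [I [SI Ia]]; apply: le_trans (Sup_ub Ia) _.
  by apply: Sup_ub; exists I.
apply: Sup_least => _ [I [SI ->]]; apply: Sup_le => a Ia; exists a.
by split; [exists I | apply: le_refl].
Qed.
Next Obligation.
(* Once both ideals are written as principal, meet preservation transfers from [principal_hom]. *)
move=> L I J; rewrite -{1}(sc_ideal_principal I) -{1}(sc_ideal_principal J).
by rewrite -(hom_meet (principal_hom L)) Sup_principal.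
Qed.
Next Obligation.
by move=> L; rewrite -(hom_top (principal_hom L)) Sup_principal.
Qed.

Definition hofmann_lawson_iso (L : Frame) : FrameIso L (sc_ideal_frame L).
Proof.
apply: (@MkFrameIso _ _ (principal_hom L) (ideal_Sup_hom L)); apply: hom_eq => x.
  exact: Sup_principal.
exact: sc_ideal_principal.
Defined.

(** * Fibres of elements of a coproduct of frames *)

Lemma initial_le (N : Frame) (p : Prop) (a c : N) :
  (p -> a <= c) -> meet a (initial N p) <= c.
Proof.
move=> H; apply: le_trans (meet_Sup _ _) _.
apply: Sup_least => _ [_ [[-> pp] ->]].
by apply: le_trans (meet_l _ _) (H pp).
Qed.

Lemma le_initial (N : Frame) (p : Prop) (a : N) : p -> a <= initial N p.
Proof. by move=> pp; apply: le_trans (le_top a) _; apply: Sup_ub. Qed.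

Section Fibre.
Variables N M : Frame.

(** Inverse image along the section that is constantly [x] in the second coordinate. By the next two
    lemmas it sends [u] to the join of the [a] with [cset u a b] for some [b] containing [x]. *)
Definition fibre (x : Hom M Omega) : Hom (N (+) M) N :=
  copair (idhom N) (apply0 N x).

Lemma le_fibre (x : Hom M Omega) (u : N (+) M) a b :
  cset u a b -> x b -> a <= fibre x u.
Proof.
move=> uab xb.
apply: le_trans (Sup_ub (a := meet a (initial N (x b))) _).
  by apply: meet_glb; [apply: le_refl | apply: le_initial].
by exists a, b.
Qed.

Lemma fibre_le (x : Hom M Omega) (u : N (+) M) c :
  (forall a b, cset u a b -> x b -> a <= c) -> fibre x u <= c.
Proof.
move=> H; apply: Sup_least => _ [a [b [uab ->]]].
by apply: initial_le => xb; apply: (H a b).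
Qed.

(** Given [cset u a b], cover [b] by the neighbourhoods of its points [p]. Then [a] lies below the
    fibre of [v] at [p], a join of elements [c] with [cset v c d] and [p] in [d]; since
    [pb_nbd p <= d], each [c] is paired with [pb_nbd p] in [v]. *)
Lemma le_of_fibres (B : PointBase M) (u v : N (+) M) :
  (forall p : pb_idx B, fibre (pb_pt p) u <= fibre (pb_pt p) v) -> u <= v.
Proof.
move=> H a b uab.
apply: (cset_down (I := v) (le_refl a) (pb_cover B b)).
apply: cset_Supr => _ [p [pb ->]].
have ap := le_trans (le_fibre uab pb) (H p).
apply: (cset_down (I := v) ap (le_refl _)).
apply: cset_Supl => _ [c [d [vcd ->]]].
apply: (cset_down (I := v) (meet_Sup _ _) (le_refl _)).
apply: cset_Supl => _ [_ [[-> pd] ->]].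
by apply: cset_down vcd; [apply: meet_l | apply: pb_nbd_le].
Qed.

Lemma eq_of_fibres (B : PointBase M) (u v : N (+) M) :
  (forall p : pb_idx B, fibre (pb_pt p) u = fibre (pb_pt p) v) -> u = v.
Proof.
by move=> H; apply: le_antisym; apply: (le_of_fibres (B := B)) => p;
  rewrite H; apply: le_refl.
Qed.

End Fibre.
Arguments fibre {N M}.

Lemma fibre_mapr (N M M' : Frame) (f : Hom M M') (x : Hom M' Omega) u :
  fibre x (coprod_map (idhom N) f u) = fibre (x \o f) u.
Proof.
have -> : fibre (N := N) (x \o f) = fibre x \o coprod_map (idhom N) f; last by [].
rewrite /fibre /coprod_map comp_copair !compA copair_inl copair_inr comp_idr.
by rewrite /apply0 compA.
Qed.

Lemma fibre_mapl (N N' M : Frame) (f : Hom N N') (x : Hom M Omega) u :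
  fibre x (coprod_map f (idhom M) u) = f (fibre x u).
Proof.
have e : fibre x \o coprod_map f (idhom M) = f \o fibre x.
  rewrite /fibre /coprod_map /apply0 !comp_copair !compA copair_inl copair_inr.
  by rewrite comp_idl !comp_idr (initial_unique (f \o _)).
exact: (f_equal (fun h : Hom _ _ => h u) e).
Qed.

(** Lets the zero and one conditions, which live in [O Y (+) Omega], be tested on a single fibre. *)
Program Definition Omega_base : PointBase Omega :=
  @MkPointBase Omega unit (fun _ => idhom Omega) (fun _ => True) _ _.
Next Obligation. by move=> p u pu _; exact: pu. Qed.
Next Obligation. by move=> p pp; exists True; split=> //; exists tt. Qed.

(** * Open prime anti-ideals of the Scott semiring as frame maps *)

Inductive finite_join (L : Frame) (S : L -> Prop) : L -> Prop :=
| finite_join_bot : finite_join S bot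
| finite_join_mem a : S a -> finite_join S a
| finite_join_join a b :
    finite_join S a -> finite_join S b -> finite_join S (join a b).

Lemma finite_join_directed (L : Frame) (S : L -> Prop) : directed (finite_join S).
Proof.
split; first by exists bot; apply: finite_join_bot.
move=> a b Sa Sb; exists (join a b); split; first exact: finite_join_join.
by split; [apply: join_l | apply: join_r].
Qed.

Section ScottOpai.
Variables (L : Frame) (contL : continuous L).
Let R := scott_semiring contL.

Definition scott_fibre (N : Frame) (u : N (+) scott_topology L) (a : L) : N :=
  fibre (scott_point a) u.

(** Each condition is tested on fibres. At the point [(a, b)] the two injections give the fibres of
    [u] at [a] and at [b], while addition and multiplication give those at [join a b] and
    [meet a b]. *)
Lemma is_opaiP (Y : Locale) (u : O Y (+) O R) :
  is_opai u <->
  scott_fibre u bot = bot /\ scott_fibre u top = top /\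
  (forall a b, scott_fibre u (join a b)
                 <= join (scott_fibre u a) (scott_fibre u b)) /\
  (forall a b, scott_fibre u (meet a b)
                 = meet (scott_fibre u a) (scott_fibre u b)).
Proof.
pose base2 := pb_coprod (scott_base contL) (scott_base contL).
have E0 (f : Hom (scott_topology L) Omega) :
    fibre (idhom Omega) (coprod_map (idhom (O Y)) f u) = fibre f u.
  by rewrite fibre_mapr comp_idl.
have El (a b : L) : fibre (pb_pt (p0 := base2) (a, b))
    (coprod_map (idhom (O Y)) inl u) = scott_fibre u a.
  by rewrite fibre_mapr /= copair_inl.
have Er (a b : L) : fibre (pb_pt (p0 := base2) (a, b))
    (coprod_map (idhom (O Y)) inr u) = scott_fibre u b.
  by rewrite fibre_mapr /= copair_inr.
have EJ (a b : L) : fibre (pb_pt (p0 := base2) (a, b))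
    (coprod_map (idhom (O Y)) (scott_join contL) u) = scott_fibre u (join a b).
  by rewrite fibre_mapr /scott_fibre -(scott_join_point contL).
have EM (a b : L) : fibre (pb_pt (p0 := base2) (a, b))
    (coprod_map (idhom (O Y)) (scott_meet contL) u) = scott_fibre u (meet a b).
  by rewrite fibre_mapr /scott_fibre -(scott_meet_point contL).
split; case=> [H0 [H1 [HJ HM]]]; split; [|split; [|split]| |split; [|split]].
- by rewrite /scott_fibre -E0 [coprod_map _ _ _]H0 hom_bot.
- by rewrite /scott_fibre -E0 [coprod_map _ _ _]H1 hom_top.
- move=> a b; rewrite -EJ -(El a b) -(Er a b) -hom_join.
  exact: hom_mono.
- move=> a b; rewrite -EM -(El a b) -(Er a b) -hom_meet.
  exact: (f_equal (fibre _)).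
- apply: (eq_of_fibres (B := Omega_base)) => p.
  rewrite hom_bot -H0; exact: E0.
- apply: (eq_of_fibres (B := Omega_base)) => p.
  rewrite hom_top -H1; exact: E0.
- apply: (le_of_fibres (B := base2)) => -[a b].
  by rewrite hom_join El Er [X in X <= _]EJ.
- apply: (eq_of_fibres (B := base2)) => -[a b].
  by rewrite hom_meet El Er [LHS]EM.
Qed.

Lemma scott_fibre_mono (N : Frame) (u : N (+) scott_topology L) a b :
  a <= b -> scott_fibre u a <= scott_fibre u b.
Proof.
move=> ab; apply: fibre_le => c U ucU Ua.
by apply: le_fibre ucU _; apply: (proj1 (ssetP U)) ab Ua.
Qed.

(** A Scott open containing [Sup D] already contains some member of [D]. *)
Lemma scott_fibre_Sup (N : Frame) (u : N (+) scott_topology L) D :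
  directed D -> scott_fibre u (Sup D) <= Sup (image (scott_fibre u) D).
Proof.
move=> dD; apply: fibre_le => c U ucU /(proj2 (ssetP U) D dD) [d [Dd Ud]].
apply: le_trans (le_fibre (x := scott_point d) ucU Ud) _.
by apply: Sup_ub; exists d.
Qed.

Program Definition hom_of_opai (Y : Locale) (u : opai_obj R Y) : Hom L (O Y) :=
  @MkHom L (O Y) (scott_fibre (proj1_sig u)) _ _ _.
Next Obligation.
move=> Y [u hu] S /=; have [u0 [_ [uJ _]]] := proj1 (is_opaiP u) hu; apply: le_antisym; last first.
  apply: Sup_least => _ [a [Sa ->]]; apply: scott_fibre_mono; exact: Sup_ub.
(* An arbitrary join is a directed join of finite joins: Scott continuity handles the former,
   induction on [finite_join] the latter. *)
have SS : Sup S <= Sup (finite_join S).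
  by apply: Sup_least => a Sa; apply: Sup_ub; apply: finite_join_mem.
apply: le_trans (scott_fibre_mono u SS) _.
apply: le_trans (scott_fibre_Sup u (finite_join_directed S)) _.
apply: Sup_least => _ [a [Sa ->]].
elim: Sa => {a} [|a Sa|a b _ IHa _ IHb].
- by rewrite u0; apply: bot_le.
- by apply: Sup_ub; exists a.
- by apply: le_trans (uJ a b) _; apply: join_lub.
Qed.
Next Obligation. by move=> Y [u hu] a b; case: (proj1 (is_opaiP u) hu) => _ [_ [_]]. Qed.
Next Obligation. by move=> Y [u hu]; case: (proj1 (is_opaiP u) hu) => _ []. Qed.

(** The largest element whose fibre at each [a] is below [f a]. *)
Program Definition hom_graph (N : Frame) (f : Hom L N) : N (+) scott_topology L :=
  @MkCoprod N (scott_topology L) (fun y U => forall a, sset U a -> y <= f a) _.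
Next Obligation.
move=> N f; split; [|split].
- by move=> y y' U U' yy UU H a /UU Ua; apply: le_trans yy (H a Ua).
- by move=> S U H a Ua; apply: Sup_least => y Sy; apply: (H y Sy).
- by move=> y S H a [U [SU Ua]]; apply: (H U).
Qed.

(** By continuity [f a] is the join of [f b] over [b] way below [a], and the graph contains [f b]
    paired with [way_up b], a neighbourhood of [a]. *)
Lemma scott_fibre_graph (N : Frame) (f : Hom L N) a :
  scott_fibre (hom_graph f) a = f a.
Proof.
apply: le_antisym; first by apply: fibre_le => y U /= H /H.
rewrite -{1}(proj2 (contL a)) hom_Sup; apply: Sup_least => _ [b [ba ->]].
apply: (le_fibre (b := way_up contL b)) => //= c /wb_le bc.
exact: hom_mono.
Qed.

Lemma hom_graph_opai (Y : Locale) (f : Hom L (O Y)) :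
  is_opai (R := R) (hom_graph f).
Proof.
apply/is_opaiP; rewrite !scott_fibre_graph hom_bot hom_top.
split=> //; split=> //; split=> a b; rewrite !scott_fibre_graph.
- by rewrite hom_join; apply: le_refl.
- exact: hom_meet.
Qed.

Definition scott_spectrum_representation :
  Representation (OPAI R) (MkLocale L).
Proof.
apply: (@MkRepresentation (OPAI R) (MkLocale L)
  (fun Y (f : Hom L (O Y)) => exist _ _ (hom_graph_opai f) : opai_obj R Y)
  (fun Y (u : opai_obj R Y) => hom_of_opai u)).
- by move=> Y f; apply: hom_eq => a /=; apply: scott_fibre_graph.
- move=> Y u; apply: opai_eq => /=.
  apply: (eq_of_fibres (B := scott_base contL)) => a.
  exact: (scott_fibre_graph (hom_of_opai u)).
- move=> Y Z f g; apply: opai_eq.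
  apply: (eq_of_fibres (B := scott_base contL)) => a.
  apply: (eq_trans (scott_fibre_graph _ a)).
  apply: eq_sym; apply: (eq_trans (fibre_mapl f (scott_point a) (hom_graph g))).
  exact: (f_equal (hom_fun f) (scott_fibre_graph g a)).
Defined.

End ScottOpai.

Theorem corollary5p5 (X : Locale) (hX : locally_compact X)
    (L : Frame) (e : FrameIso L (O X)) :
  let R := scott_semiring (continuous_iso e hX) in
  (exists S : Locale, is_localic_spectrum R S) /\
  (forall S : Locale, is_localic_spectrum R S ->
     loc_isomorphic S X /\ loc_isomorphic S (hofmann_lawson_spectrum L)).
Proof.
move=> R; have r : Representation (OPAI R) (MkLocale L).
  exact: scott_spectrum_representation.
split; first by exists (MkLocale L).
move=> S [s]; have SL := representation_unique s r.
split; apply: loc_isomorphic_trans SL _; last first.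
  exact: frame_iso_loc (hofmann_lawson_iso L).
(* Destructing [X] exhibits it as [MkLocale] of its frame, so that [e] yields the isomorphism. *)
by case: X hX e @R r {s} => X *; apply: frame_iso_loc.
Qed.
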